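(* Let $a\ge 3$ be an odd integer. Then $$\begin{cases}\Gamma(a,a+2)=0\ \text{ and }\ \Gamma(a^2,(a+2)^2)=0,&\text{if } a\equiv 1\pmod 8,\\ \Gamma(a,a+2)=1\ \text{ and }\ \Gamma(a^2,(a+2)^2)=1,&\text{if } a\equiv 3\pmod 8,\\ \Gamma(a,a+2)=0\ \text{ and }\ \Gamma(a^2,(a+2)^2)=1,&\text{if } a\equiv 5\pmod 8,\\ \Gamma(a,a+2)=1\ \text{ and }\ \Gamma(a^2,(a+2)^2)=0,&\text{if } a\equiv 7\pmod 8.\end{cases}$$
   Context: For coprime positive integers $a,b$, it is known that exactly one of the two equations $ax+by=\frac{(a-1)(b-1)}{2}$ and $1+ax+by=\frac{(a-1)(b-1)}{2}$ has a solution in nonnegative integers $x,y$. Define $\Gamma(a,b)=0$ if the first equation has such a solution, and $\Gamma(a,b)=1$ if the second does. *)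

(* Defs.v *)
From mathcomp Require Import all_boot zify.

Set Implicit Arguments.
Unset Strict Implicit.
Unset Printing Implicit Defensive.

(** [halfprod a b] is an exact half when [a] and [b] are coprime, since then at
    least one of them is odd; see [halfprodE]. *)
Definition halfprod (a b : nat) : nat := ((a - 1) * (b - 1)) %/ 2.

Definition eqn0_solvable (a b : nat) : Prop :=
  exists x y : nat, a * x + b * y = halfprod a b.

Definition eqn1_solvable (a b : nat) : Prop :=
  exists x y : nat, 1 + a * x + b * y = halfprod a b.

Lemma lin_dec (a b c m : nat) :
  decidable (exists x y : nat, c + a * x + b * y = m).
Proof.
apply: (@decP _ [exists x : 'I_m.+1, [exists y : 'I_m.+1,
                   c + a * x + b * y == m]]).
apply: (iffP existsP) => [[x /existsP[y /eqP e]]|[x [y e]]].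
  by exists x, y.
have bound k z : k * z <= m -> exists t : 'I_m.+1, k * t = k * z.
  case: k => [|k] le_kz_m; first by exists ord0.
  have lt_z : z < m.+1 by apply: leq_trans le_kz_m; rewrite leq_pmull.
  by exists (Ordinal lt_z).
have [|s es] := bound a x; first by lia.
have [|t et] := bound b y; first by lia.
by exists s; apply/existsP; exists t; rewrite es et e.
Qed.

Lemma eqn0_dec (a b : nat) : decidable (eqn0_solvable a b).
Proof. exact: (lin_dec a b 0 (halfprod a b)). Qed.

Lemma eqn1_dec (a b : nat) : decidable (eqn1_solvable a b).
Proof. exact: (lin_dec a b 1 (halfprod a b)). Qed.

(** The value 2 is a junk value: it is never taken when [a] and [b] are coprime
    and positive, by [eqn_exactly_one] below. *)
Definition Gamma (a b : nat) : nat :=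
  if eqn0_dec a b then 0 else if eqn1_dec a b then 1 else 2.

Lemma halfprodE (a b : nat) : coprime a b ->
  2 * halfprod a b = (a - 1) * (b - 1).
Proof.
move=> co_ab; rewrite mulnC divnK // dvdn2 oddM.
case: (boolP (odd a)) => [oa|ea].
  by case: a oa {co_ab} => //= a oa; rewrite subn1 (negbTE oa).
have ob : odd b.
  apply: contraLR co_ab => eb; apply/negP => /eqP g1.
  have : 2 %| gcdn a b by rewrite dvdn_gcd !dvdn2 ea eb.
  by rewrite g1.
by case: b ob {co_ab} => //= b ob; rewrite (subn1 b.+1) (negbTE ob) andbF.
Qed.

Lemma eqn_exactly_one (a b : nat) : 0 < a -> 0 < b -> coprime a b ->
  (eqn0_solvable a b /\ ~ eqn1_solvable a b) \/
  (~ eqn0_solvable a b /\ eqn1_solvable a b).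
Proof.
move=> a0 b0 co_ab; have := halfprodE co_ab.
rewrite /eqn0_solvable /eqn1_solvable; set N := halfprod a b => eN.
have {}eN : 2 * N + a + b = a * b + 1.
  rewrite eN; case: a a0 {co_ab N eN} => // a _; case: b b0 => // b _.
  by rewrite !subn1 /= mulSn mulnS; lia.
have excl : ~ ((exists x y, a * x + b * y = N) /\
               (exists x y, 1 + a * x + b * y = N)).
  case=> [[x [y e]] [x' [y' e']]].
  have eab : a * b = a * (x + x' + 1) + b * (y + y' + 1).
    by rewrite !mulnDr; lia.
  have : b %| a * (x + x' + 1).
    by rewrite -(dvdn_addl _ (dvdn_mulr (y + y' + 1) (dvdnn b))) -eab dvdn_mull.
  rewrite Gauss_dvdr 1?coprime_sym // => /dvdn_leq le_b.
  have {le_b}: b <= x + x' + 1 by apply: le_b; lia.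
  rewrite -(leq_pmul2l a0) eab -[leqRHS]addn0 leq_add2l leqNgt muln_gt0 b0.
  by rewrite addn1.
suff [s|s] : (exists x y, a * x + b * y = N) \/
             (exists x y, 1 + a * x + b * y = N).
- by left; split=> // t; apply: excl.
- by right; split=> // t; apply: excl.
have [x [lt_xb ex]] : exists x, x < b /\ a * x = N %[mod b].
  case: (egcdnP b a0) => u v e _.
  have g1 : gcdn a b = 1 by apply/eqP.
  exists ((u * N) %% b); split; first by rewrite ltn_mod.
  rewrite modnMmr mulnA (mulnC a) e g1 mulnDl mul1n.
  by rewrite mulnAC modnMDl.
case: (leqP (a * x) N) => [le|lt].
  have /dvdnP[y ey] : b %| N - a * x by rewrite -eqn_mod_dvd // ex.
  by left; exists x, y; rewrite (mulnC b); lia.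
have /dvdnP[k ek] : b %| a * x - N by rewrite -eqn_mod_dvd ?ex // ltnW.
right; case: k ek => [|k] ek; first by lia.
exists (b - x.+1), k.
have eb : a * b = a * (b - x.+1) + a * x + a.
  by rewrite -{1}(subnK lt_xb) mulnDr mulnS; lia.
by move: ek; rewrite mulSn (mulnC k); lia.
Qed.

Lemma Gamma_eq0 (a b : nat) : Gamma a b = 0 <-> eqn0_solvable a b.
Proof. by rewrite /Gamma; case: eqn0_dec => //; case: eqn1_dec. Qed.

Lemma Gamma_eq1 (a b : nat) : 0 < a -> 0 < b -> coprime a b ->
  Gamma a b = 1 <-> eqn1_solvable a b.
Proof.
move=> a0 b0 co_ab; have := eqn_exactly_one a0 b0 co_ab.
by rewrite /Gamma; case: eqn0_dec => s0; case: eqn1_dec => s1 h; split=> //; tauto.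
Qed.

(* Main.v *)
Require Import Defs.
From mathcomp Require Import all_boot zify.

(** Write [b = a + 2].  Each of the eight claims holds because the relevant
    equation has an explicit solution, polynomial in [a].  For [(a, b)], take
    [x = y = (a - 1)/4] in the first equation when [a] is 1 modulo 4, and
    [(x, y) = ((a + 1)/4, (a - 3)/4)] in the second when [a] is 3 modulo 4.

    For the squares, [1 - a] inverts [1 + a] modulo [a ^ 2], so reducing the
    two equations modulo [a ^ 2] gives [8 y = - (a + 3)] and [8 y = a - 5]
    respectively.  The map [a |-> - b] exchanges [a ^ 2] and [b ^ 2], so modulo
    [b ^ 2] it gives [8 x = a - 1] and [8 x = - a - 7].  Hence [8 y] and [8 x]
    are these linear terms plus multiples [j * a ^ 2] and [i * b ^ 2], where
    divisibility by 8 determines [j] modulo 8 and comparing leading terms gives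
    [i + j = 4].  The nonnegative solutions are
    - [a = 1 %[mod 8]], first equation:
      [8 x = a - 1] and [8 y = 4 a ^ 2 - a - 3];
    - [a = 3 %[mod 8]], second equation:
      [8 x = 2 a ^ 2 + 7 a + 1] and [8 y = 2 a ^ 2 + a - 5];
    - [a = 5 %[mod 8]], second equation:
      [8 x = 4 a ^ 2 + 15 a + 9] and [8 y = a - 5];
    - [a = 7 %[mod 8]], first equation:
      [8 x = 2 a ^ 2 + 9 a + 7] and [8 y = 2 a ^ 2 - a - 3].

    Solvability of the second equation forces the value 1 of [Gamma] only for
    coprime arguments; odd [a] and [a + 2] are coprime, and so are their
    squares. *)

Lemma halfprod_succ (m n h : nat) :
  m * n = 2 * h -> halfprod m.+1 n.+1 = h.
Proof. by rewrite /halfprod !subn1 /= => ->; rewrite mulKn. Qed.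

Lemma halfprod_odd_twins (c : nat) :
  halfprod (2 * c + 1) (2 * c + 1 + 2) = 2 * c * (c + 1).
Proof.
have -> : 2 * c + 1 + 2 = (2 * c + 2).+1 by lia.
by rewrite addn1; apply: halfprod_succ; lia.
Qed.

Lemma halfprod_odd_twin_squares (c : nat) :
  halfprod ((2 * c + 1) ^ 2) ((2 * c + 1 + 2) ^ 2)
    = 8 * c * (c + 1) ^ 2 * (c + 2).
Proof.
have -> : (2 * c + 1) ^ 2 = (4 * c * (c + 1)).+1 by rewrite -!mulnn; lia.
have -> : (2 * c + 1 + 2) ^ 2 = (4 * (c + 1) * (c + 2)).+1.
  by rewrite -!mulnn; lia.
by apply: halfprod_succ; rewrite -!mulnn; lia.
Qed.

Lemma coprime_odd_add2 (a : nat) : odd a -> coprime a (a + 2).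
Proof. by move=> oa; rewrite /coprime gcdnDl -/(coprime a 2) coprimen2. Qed.

Lemma Gamma_twins_eq0 (a m : nat) : a = 4 * m + 1 -> Gamma a (a + 2) = 0.
Proof.
move=> ->; apply/Gamma_eq0; exists m, m.
by have := halfprod_odd_twins (2 * m); rewrite mulnA => ->; lia.
Qed.

Lemma Gamma_twins_eq1 (a m : nat) : a = 4 * m + 3 -> Gamma a (a + 2) = 1.
Proof.
move=> ea; apply/Gamma_eq1; [lia | lia | apply: coprime_odd_add2; lia |].
exists m.+1, m; have -> : a = 2 * (2 * m + 1) + 1 by lia.
by rewrite halfprod_odd_twins; lia.
Qed.

Lemma Gamma_twin_squares_eq0 (a c x y : nat) : a = 2 * c + 1 ->
    a ^ 2 * x + (a + 2) ^ 2 * y = 8 * c * (c + 1) ^ 2 * (c + 2) ->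
  Gamma (a ^ 2) ((a + 2) ^ 2) = 0.
Proof.
move=> -> e; apply/Gamma_eq0; exists x, y.
by rewrite halfprod_odd_twin_squares.
Qed.

Lemma Gamma_twin_squares_eq1 (a c x y : nat) : a = 2 * c + 1 ->
    1 + a ^ 2 * x + (a + 2) ^ 2 * y = 8 * c * (c + 1) ^ 2 * (c + 2) ->
  Gamma (a ^ 2) ((a + 2) ^ 2) = 1.
Proof.
move=> -> e; apply/Gamma_eq1; first by rewrite expn_gt0 addn1.
- by rewrite expn_gt0 !addnS.
- by rewrite coprime_pexpl // coprime_pexpr // coprime_odd_add2; lia.
by exists x, y; rewrite halfprod_odd_twin_squares.
Qed.

Theorem theorem4p9 (a : nat) (a_ge3 : 3 <= a) (a_odd : odd a) :
  (a = 1 %[mod 8] -> Gamma a (a + 2) = 0 /\ Gamma (a ^ 2) ((a + 2) ^ 2) = 0) /\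
  (a = 3 %[mod 8] -> Gamma a (a + 2) = 1 /\ Gamma (a ^ 2) ((a + 2) ^ 2) = 1) /\
  (a = 5 %[mod 8] -> Gamma a (a + 2) = 0 /\ Gamma (a ^ 2) ((a + 2) ^ 2) = 1) /\
  (a = 7 %[mod 8] -> Gamma a (a + 2) = 1 /\ Gamma (a ^ 2) ((a + 2) ^ 2) = 0).
Proof.
(* The witnesses below are the solutions for the squares, with [a = 8 k + r]
   substituted and the division by 8 carried out. *)
have decomp r : a = r %[mod 8] -> r < 8 -> exists k, a = 8 * k + r.
  by move=> e lt_r; exists (a %/ 8); lia.
split=> [/decomp[]// k ea|].
  split; first by apply: (@Gamma_twins_eq0 _ (2 * k)); lia.
  apply: (@Gamma_twin_squares_eq0 _ (4 * k) k ((32 * k + 7) * k)); first lia.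
  by rewrite ea -!mulnn; lia.
split=> [/decomp[]// k ea|].
  split; first by apply: (@Gamma_twins_eq1 _ (2 * k)); lia.
  apply: (@Gamma_twin_squares_eq1 _ (4 * k + 1) (16 * k * k + 19 * k + 5)
            (16 * k * k + 13 * k + 2)); first lia.
  by rewrite ea -!mulnn; lia.
split=> [/decomp[]// k ea|/decomp[]// k ea].
  split; first by apply: (@Gamma_twins_eq0 _ (2 * k + 1)); lia.
  apply: (@Gamma_twin_squares_eq1 _ (4 * k + 2) (32 * k * k + 55 * k + 23) k).
    by lia.
  by rewrite ea -!mulnn; lia.
split; first by apply: (@Gamma_twins_eq1 _ (2 * k + 1)); lia.
apply: (@Gamma_twin_squares_eq0 _ (4 * k + 3) ((16 * k + 21) * (k + 1))
          ((16 * k + 11) * (k + 1))); first lia.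
by rewrite ea -!mulnn; lia.
Qed.
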